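(* Let $\mathcal{D}$ be a quantitative transaction database over a finite item set $I$ with external utilities $eu$, a given membership function, a total processing order on $I$, and a minimum fuzzy utility threshold $\gamma$. Let $X$ be a fuzzy itemset. If $$\mathrm{sumIfu}(X)+\mathrm{sumRfu}(X)<\gamma ,$$ then no extension $X'$ of $X$ is a high fuzzy utility itemset, i.e. $fu_{X'}<\gamma$ for every extension $X'$ of $X$.
   Context: Database. $I=\{x_1,\dots,x_m\}$ is a finite set of items; each item $x_i$ has a positive external (unit) utility $eu(x_i)$. A quantitative database $\mathcal{D}=\{T_1,\dots,T_n\}$ is a finite collection of transactions; each $T_j$ assigns to every item $x_i$ a quantity $q(x_i,T_j)\ge 0$, and $x_i\in T_j$ means $q(x_i,T_j)>0$. Membership. Each item $x_i$ has finitely many fuzzy regions $R_{i1},R_{i2},\dots$ (e.g. Low, Middle, High). The membership function converts the quantity $q(x_i,T_j)$ into membership values $f_{ijl}\in[0,1]$, one for each region $R_{il}$. A fuzzy item is a pair (item $x_i$, region $R_{il}$). A fuzzy itemset $X$ is a nonempty finite set of fuzzy items with at most one region chosen for each item. $X\subseteq T_j$ means that all underlying items of $X$ belong to $T_j$. Fuzzy utility. For $x_i\in T_j$, the fuzzy utility of the $l$-th region is $fu_{ijl}=f_{ijl}\cdot q(x_i,T_j)\cdot eu(x_i)$, and the maximum fuzzy utility of $x_i$ in $T_j$ is $mfu_{ij}=\max_l fu_{ijl}$. For a fuzzy itemset $X\subseteq T_j$, $fu_{jX}=f_{jX}\cdot\sum_{x_i}q(x_i,T_j)\,eu(x_i)$,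 where the sum is over the underlying items of $X$ and $f_{jX}$ is the minimum of the membership values in $T_j$ of the fuzzy items of $X$. The total fuzzy utility is $fu_X=\sum_{T_j\in\mathcal{D},\,X\subseteq T_j}fu_{jX}$. $X$ is a high fuzzy utility itemset (HFUI) if $fu_X\ge\gamma$. Order and extensions. A total order on $I$ is fixed (the processing order). $T_j/X$ denotes the set of items of $T_j$ that come after all underlying items of $X$ in this order. An extension of $X$ is a fuzzy itemset $X'\supsetneq X$ such that the underlying items of all fuzzy items in $X'\setminus X$ come after all underlying items of $X$. Fuzzy-list. For $X\subseteq T_j$ put $ifu(X,T_j)=fu_{jX}$ and $rfu(X,T_j)=\sum_{x_i\in T_j/X}mfu_{ij}$. Then $\mathrm{sumIfu}(X)=\sum_{T_j\supseteq X}ifu(X,T_j)$ and $\mathrm{sumRfu}(X)=\sum_{T_j\supseteq X}rfu(X,T_j)$, the sums being over all $T_j\in\mathcal{D}$ with $X\subseteq T_j$. *)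

(* Defs.v *)
From HB Require Import structures.
From mathcomp Require Import all_boot all_order all_algebra.

Set Implicit Arguments.
Unset Strict Implicit.
Unset Printing Implicit Defensive.

Import Order.TTheory GRing.Theory Num.Theory.
Local Open Scope ring_scope.

(* The transactions are a family indexed by 'I_ntrans, so that repeated
   transactions are allowed. *)
Record quant_db (R : realFieldType) (I : finType) := QuantDb {
  eu : I -> R;
  eu_gt0 : forall x, 0 < eu x;
  ntrans : nat;
  qty : I -> 'I_ntrans -> R;
  qty_ge0 : forall x j, 0 <= qty x j
}.

(* memb l v is the membership value in the region l of an item bought in
   quantity v. *)
Record membership (R : realFieldType) (I : finType) := Membership {
  nreg : I -> nat;
  memb : forall x, 'I_(nreg x) -> R -> R;
  memb_itv : forall x (l : 'I_(nreg x)) v, 0 <= v -> 0 <= memb l v <= 1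
}.

Section FuzzyUtility.

Variables (R : realFieldType) (disp : Order.disp_t) (I : finOrderType disp).
Variables (D : quant_db R I) (M : membership R I).

Definition fuzzy_item : finType := {x : I & 'I_(nreg M x)}.

Implicit Types (X : {set fuzzy_item}) (j : 'I_(ntrans D)).

Definition items X : {set I} := [set tag a | a in X].

Definition is_fuzzy_itemset X : Prop :=
  X != set0 /\ {in X &, forall a b, tag a = tag b -> a = b}.

Definition trans_items j : {set I} := [set x | 0 < qty x j].

Definition contained X j : bool := items X \subset trans_items j.

Definition fval j (a : fuzzy_item) : R := memb (tagged a) (qty (tag a) j).

Definition region_fu x j (l : 'I_(nreg M x)) : R :=
  memb l (qty x j) * qty x j * eu D x.

(* The default value 0 does not affect the maximum, as the fuzzy utilities
   are nonnegative. *)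
Definition mfu x j : R := \big[Order.max/0]_(l < nreg M x) region_fu j l.

(* The default value 1 does not affect the minimum over a nonempty X, as the
   membership values are at most 1. *)
Definition min_fval X j : R := \big[Order.min/1]_(a in X) fval j a.

Definition fu_in X j : R :=
  min_fval X j * \sum_(x in items X) qty x j * eu D x.

Definition fu X : R := \sum_(j | contained X j) fu_in X j.

Definition is_hfui (gamma : R) X : bool := gamma <= fu X.

(* The processing order is the order of I. *)
Definition after X : {set I} := [set x | [forall y in items X, (y < x)%O]].

Definition remaining X j : {set I} := trans_items j :&: after X.

Definition is_extension X X' : Prop :=
  [/\ is_fuzzy_itemset X', X \proper X' &
      {in X' :\: X, forall a, tag a \in after X}].

Definition ifu X j : R := fu_in X j.

Definition rfu X j : R := \sum_(x in remaining X j) mfu x j.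

Definition sumIfu X : R := \sum_(j | contained X j) ifu X j.

Definition sumRfu X : R := \sum_(j | contained X j) rfu X j.

End FuzzyUtility.

(* Main.v *)
(** On a transaction containing [X'], enlarging [X] to [X'] only lowers the
    minimal membership value: on the items of [X] this bounds the utility by
    [ifu], and on each new item it is at most the membership value of the
    region chosen there, so that item contributes at most its [mfu]; the new
    items all lie in the remaining part of the transaction. Transactions
    containing [X] but not [X'] contribute nonnegatively to the bound. *)
Require Import Defs.
From mathcomp Require Import all_boot all_order all_algebra.

Set Implicit Arguments.
Unset Strict Implicit.
Unset Printing Implicit Defensive.

Import Order.TTheory GRing.Theory Num.Theory.
Local Open Scope ring_scope.

Section FuzzyUtilityBounds.

Variables (R : realFieldType) (disp : Order.disp_t) (I : finOrderType disp).
Variables (D : quant_db R I) (M : membership R I).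
Implicit Types (X Y : {set fuzzy_item M}) (j : 'I_(ntrans D)).

Lemma itemsS X Y : X \subset Y -> items X \subset items Y.
Proof. exact: imsetS. Qed.

Lemma fval_ge0 j (a : fuzzy_item M) : 0 <= fval j a.
Proof. by case/andP: (memb_itv (tagged a) (qty_ge0 (tag a) j)). Qed.

Lemma item_utility_ge0 x j : 0 <= qty x j * eu D x.
Proof. by rewrite mulr_ge0 ?qty_ge0 ?ltW ?eu_gt0. Qed.

Lemma min_fval_ge0 X j : 0 <= min_fval X j.
Proof. by apply: le_bigmin => // a _; exact: fval_ge0. Qed.

Lemma min_fval_le X j a : a \in X -> min_fval X j <= fval j a.
Proof. exact: bigmin_le_cond. Qed.

Lemma min_fvalS X Y j : X \subset Y -> min_fval Y j <= min_fval X j.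
Proof.
(* The default value 1 takes part in the minimum over [X], so it needs a bound as well. *)
move=> /subsetP sXY; apply: le_bigmin; first exact: bigmin_le_id.
by move=> a /sXY; exact: min_fval_le.
Qed.

Lemma mfu_ge0 x j : 0 <= mfu M x j.
Proof. exact: bigmax_ge_id. Qed.

(** The region of [a] is one of those over which [mfu] takes the maximum. *)
Lemma fval_le_mfu j (a : fuzzy_item M) :
  fval j a * (qty (tag a) j * eu D (tag a)) <= mfu M (tag a) j.
Proof.
rewrite mulrA.
exact: (le_bigmax _ (fun l : 'I_(nreg M (tag a)) => region_fu j l) (tagged a)).
Qed.

Lemma fu_in_ge0 X j : 0 <= fu_in X j.
Proof.
apply: mulr_ge0; first exact: min_fval_ge0.
by apply: sumr_ge0 => x _; exact: item_utility_ge0.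
Qed.

Lemma rfu_ge0 X j : 0 <= rfu X j.
Proof. by apply: sumr_ge0 => x _; exact: mfu_ge0. Qed.

Lemma containedS X Y j : X \subset Y -> contained Y j -> contained X j.
Proof. by move=> /itemsS; exact: subset_trans. Qed.

Lemma extension_new_items X Y j : is_extension X Y -> contained Y j ->
  items Y :\: items X \subset remaining X j.
Proof.
move=> [_ _ new_after] /subsetP cY; apply/subsetP => x /setDP[xY xX].
rewrite inE cY //=; case/imsetP: xY xX => a aY -> aX.
(* Since [tag a] is not an item of [X], [a] itself is not in [X], so the extension condition applies
   to it. *)
by apply: new_after; rewrite inE aY andbT; apply: contraNN aX; exact: imset_f.
Qed.

Lemma fu_in_extension X Y j : is_extension X Y -> contained Y j ->
  fu_in Y j <= ifu X j + rfu X j.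
Proof.
move=> extXY cY; have [_ /proper_sub sXY _] := extXY.
rewrite /ifu /fu_in (big_setID (items X)) /= (setIidPr (itemsS sXY)) mulrDr.
apply: lerD.
  apply: ler_wpM2r; last exact: min_fvalS.
  by apply: sumr_ge0 => x _; exact: item_utility_ge0.
(* Remaining items outside [Y] only add nonnegative terms to [rfu], so they are split off and
   dropped. *)
rewrite /rfu [leRHS](big_setID (items Y :\: items X)) /=.
rewrite (setIidPr (extension_new_items extXY cY)) mulr_sumr.
apply: ler_wpDr; first by apply: sumr_ge0 => x _; exact: mfu_ge0.
apply: ler_sum => x /setDP[/imsetP[a aY ->] _].
apply: le_trans (fval_le_mfu j a).
by apply: ler_wpM2r; [exact: item_utility_ge0 | exact: min_fval_le].
Qed.

Lemma fu_extension X Y : is_extension X Y -> fu D Y <= sumIfu D X + sumRfu D X.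
Proof.
move=> extXY; have [_ /proper_sub sXY _] := extXY.
(* The two sums range over different transactions; padding both with zeros allows a termwise
   comparison. *)
rewrite /sumIfu /sumRfu -big_split /= /fu big_mkcond [leRHS]big_mkcond /=.
apply: ler_sum => j _; case: ifPn => [cY | _].
  by rewrite (containedS sXY cY) fu_in_extension.
by case: ifP => // _; rewrite addr_ge0 ?fu_in_ge0 ?rfu_ge0.
Qed.

End FuzzyUtilityBounds.

Theorem theorem4 (R : realFieldType) (disp : Order.disp_t)
    (I : finOrderType disp) (D : quant_db R I) (M : membership R I)
    (gamma : R) (X : {set fuzzy_item M}) (hX : is_fuzzy_itemset X)
    (hsum : sumIfu D X + sumRfu D X < gamma) :
  forall X' : {set fuzzy_item M}, is_extension X X' -> ~~ is_hfui D gamma X'.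
Proof.
move=> X' extX; rewrite /is_hfui -ltNge.
apply: le_lt_trans (fu_extension D extX) hsum.
Qed.
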